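(* There exists $C>0$ such that for every $d=d(n)\ge 1$, every $n$-vertex $Cd^2\log^2 n$-connected graph is $d$-rigid.
   Context: A graph $G=(V,E)$ (with at least $d+1$ vertices) is $d$-rigid if there is an embedding $\mathbf p:V\to\mathbb R^d$ whose rigidity matrix $\mathsf R(G,\mathbf p)$ (rows indexed by edges, $d$ columns per vertex, the row of $\{u,v\}$ being $\mathbf p(u)-\mathbf p(v)$ at $u$, $\mathbf p(v)-\mathbf p(u)$ at $v$, zero elsewhere) has rank $d|V|-\binom{d+1}{2}$. Logarithms are natural. *)

(* Defs.v *)
From mathcomp Require Import all_boot all_order all_algebra.
From mathcomp Require Import reals exp.

Set Implicit Arguments.
Unset Strict Implicit.
Unset Printing Implicit Defensive.

Import Order.TTheory GRing.Theory Num.Theory.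

Local Open Scope ring_scope.

Record sgraph := SGraph {
  vertex :> finType;
  adj : rel vertex;
  adj_sym : symmetric adj;
  adj_irr : irreflexive adj }.

Definition edges (G : sgraph) : {set {set G}} :=
  [set A | [exists u : G, exists v : G, adj u v && (A == [set u; v])]].

Definition adj_minus (G : sgraph) (S : {set G}) : rel G :=
  fun u v => [&& u \notin S, v \notin S & adj u v].

Definition k_connected (k : nat) (G : sgraph) : Prop :=
  (k < #|G|)%N /\
  forall S : {set G}, (#|S| < k)%N ->
    forall u v : G, u \notin S -> v \notin S -> connect (adj_minus S) u v.

(* For an edge A = {u, v} the sum over x in A of p w - p x has a single
   possibly nonzero term when w is in A: it is p u - p v at w = u and
   p v - p u at w = v.  Flattening with mxvec gives d consecutive columns
   per vertex. *)
Definition rigidity_mx (R : realType) (d : nat) (G : sgraph)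
    (p : G -> 'rV[R]_d) : 'M[R]_(#|edges G|, #|G| * d) :=
  \matrix_(i < #|edges G|)
    mxvec (\matrix_(j < #|G|, c < d)
      let A : {set G} := enum_val i in
      let w : G := enum_val j in
      if w \in A then \sum_(x in A) (p w - p x) 0 c else 0).

(* The subtraction does not truncate, since d + 1 <= #|G|. *)
Definition d_rigid (R : realType) (d : nat) (G : sgraph) : Prop :=
  (d < #|G|)%N /\
  exists p : G -> 'rV[R]_d,
    injective p /\ \rank (rigidity_mx p) = (d * #|G| - 'C(d.+1, 2))%N.

(* Main.v *)
Require Import Defs.
From mathcomp Require Import all_boot all_order all_algebra all_fingroup.
From mathcomp Require Import boolp reals exp.
From mathcomp Require Import zify ring lra.

(** Only k >= 3 (d + 1)^2 is used.  At a generic embedding, let H be the closure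
of G in the rigidity matroid.  Insert the vertices in a uniformly random order.
A vertex v with N already inserted H-neighbours raises the rank by at least
min(d, |N|) (0-extension), and by at least d + 1 if |N| > d and N is not a
clique of H, since then a missing pair in N is outside the span of the rows
(1-extension).  If no vertex has an H-neighbourhood that is a clique, then each
v gains more than d on average, because two fixed nonadjacent neighbours precede
v with probability 1/3 while few neighbours precede it with probability O(1/d);
the rank would then exceed the number d n of columns.  Hence some vertex is
simplicial.  Deleting it lowers the rank by at least d and preserves
connectivity, so the argument repeats until H is a clique, which yields the rank
d n - C(d + 1, 2); the reverse inequality comes from the trivial motions. *)

(** * Random orders and growing rank functions *)

(** Induction removes the last vertex of [U]: it gains over all the rest of [U], and its removal
    changes no other set of predecessors. *)
Lemma sum_gains_le (V : finType) (rk : {set V} -> nat) (g : V -> {set V} -> nat)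
    (ord : V -> nat) :
  injective ord ->
  (forall v (U : {set V}), v \notin U -> rk U + g v U <= rk (v |: U)) ->
  forall U : {set V}, \sum_(v in U) g v [set u in U | ord u < ord v] <= rk U.
Proof.
move=> inj_ord gain U; have [m cU] := ubnP #|U|; elim: m U cU => // m IH U cU.
have [-> | [v0 v0U]] := set_0Vmem U; first by rewrite big_set0.
case: (arg_maxnP ord v0U) => v /= vU maxv; have {}vU : v \in U by [].
have vU' : v \notin U :\ v by rewrite !inE eqxx.
have := gain v _ vU'; rewrite setD1K //; apply: leq_trans.
rewrite (big_setD1 v) //= addnC leq_add //.
  have cU' : #|U :\ v| < m by have := cardsD1 v U; rewrite vU; lia.
  apply: leq_trans (IH _ cU'); apply: leq_sum => w /setD1P[_ wU].
  apply/eq_leq; congr g; apply/setP => u; rewrite !inE.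
  by case: eqVneq => //= ->; rewrite ltnNge maxv // andbF.
apply/eq_leq; congr g; apply/setP => u; rewrite !inE andbC.
case: (boolP (u \in U)) => uU; last by rewrite !andbF.
by rewrite !andbT ltn_neqAle (inj_eq inj_ord) (maxv _ uU) andbT.
Qed.

Section RandomOrder.
Context {V : finType}.
Implicit Types (s : {perm V}) (S : {set V}) (v w : V).

(** Every permutation yields a linear order, so sums over permutations are unnormalised expectations
    over uniform random orders. *)
Definition ord_of s v : nat := enum_rank (s v).

Lemma ord_of_inj s : injective (ord_of s).
Proof. by move=> u v /ord_inj /enum_rank_inj /perm_inj. Qed.

Definition pos s S v : nat := #|[set u in S | ord_of s u < ord_of s v]|.

Lemma pos_lt s S v w : v \in S -> ord_of s v < ord_of s w -> pos s S v < pos s S w.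
Proof.
move=> vS lt; apply: proper_card; apply/properP; split.
  apply/subsetP => u; rewrite !inE => /andP[-> /=] /ltn_trans; exact.
by exists v; rewrite !inE ?vS ?lt ?ltnn.
Qed.

Lemma pos_inj s S : {in S &, injective (pos s S)}.
Proof.
move=> v w vS wS eq; apply: (@ord_of_inj s).
by case: (ltngtP (ord_of s v) (ord_of s w)) => // /pos_lt;
  [move=> /(_ _ vS) | move=> /(_ _ wS)]; rewrite eq ltnn.
Qed.

Lemma sum_pos_le s S d : \sum_(w in S) (pos s S w <= d) <= d.+1.
Proof.
rewrite -[leqLHS]big_mkcondr sum1_card -[leqRHS]card_ord.
rewrite -(@card_in_imset _ _ (fun w => inord (pos s S w) : 'I_d.+1)) ?max_card //.
move=> v w /andP[vS pv] /andP[wS pw] eq; apply: (pos_inj s S) => //.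
by have := congr1 val eq; rewrite /= !inordK.
Qed.

Lemma sum_pos_last s S : S != set0 -> 0 < \sum_(w in S) (pos s S w == #|S|.-1).
Proof.
case/set0Pn => v0 v0S; case: (arg_maxnP (ord_of s) v0S) => v /= vS maxv; have {}vS : v \in S by [].
rewrite (bigD1 v) //=; suff -> : pos s S v = #|S|.-1 by rewrite eqxx.
have -> : #|S|.-1 = #|S :\ v| by have := cardsD1 v S; rewrite vS; lia.
rewrite /pos; congr #|pred_of_set _|; apply/setP => u; rewrite !inE andbC.
case: (boolP (u \in S)) => uS; last by rewrite !andbF.
by rewrite !andbT ltn_neqAle (inj_eq (@ord_of_inj s)) (maxv _ uS) andbT.
Qed.

(** Precomposing with the transposition swaps the places of [v] and [w]; since both lie in [S], the
    places taken by [S] stay the same. *)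
Lemma pos_tperm s S v w : v \in S -> w \in S -> pos (tperm v w * s) S v = pos s S w.
Proof.
move=> vS wS; rewrite /pos -(card_imset _ (@perm_inj _ (tperm v w))).
rewrite (can_imset_pre _ (tpermK v w)); congr #|pred_of_set _|.
apply/setP => u; rewrite !inE /ord_of !permM tpermK tpermL; congr (_ && _).
by case: tpermP => // ->; rewrite ?vS ?wS.
Qed.

(** The swap of [v] with [w] is a bijection on orders, so all elements of [S] contribute equally:
    the position of [v] in [S] is uniform. *)
Lemma sum_perm_pos S v (Q : pred nat) : v \in S ->
  #|S| * \sum_s Q (pos s S v) = \sum_s \sum_(w in S) Q (pos s S w).
Proof.
move=> vS; rewrite exchange_big /= -sum_nat_const; apply: eq_bigr => w wS.
rewrite (reindex_inj (mulgI (tperm v w))) /=.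
by apply: eq_bigr => s _; rewrite pos_tperm.
Qed.

Lemma sum_perm_pos_le S v d : v \in S ->
  #|S| * \sum_s (pos s S v <= d) <= d.+1 * #|{perm V}|.
Proof.
move=> vS; rewrite (sum_perm_pos S v (fun i => i <= d)) // mulnC -sum_nat_const.
by apply: leq_sum => s _; exact: sum_pos_le.
Qed.

Lemma sum_perm_pos_last S v : v \in S ->
  #|{perm V}| <= #|S| * \sum_s (pos s S v == #|S|.-1).
Proof.
move=> vS; rewrite (sum_perm_pos S v (fun i => i == #|S|.-1)) //.
rewrite -[leqLHS]muln1 -sum_nat_const; apply: leq_sum => s _.
by apply: sum_pos_last; apply/set0Pn; exists v.
Qed.

End RandomOrder.

(** * Rank bounds for highly connected relations *)

Lemma connect_ind_closed (T : finType) (e : rel T) (P : T -> Prop) x y :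
  (forall a b, e a b -> P a -> P b) -> connect e x y -> P x -> P y.
Proof.
move=> step /connectP[s]; elim: s x => [|z s IH] x /=; first by move=> _ ->.
by case/andP => xz ps lastE Px; apply: IH ps lastE _; exact: step xz Px.
Qed.

(** The term ['C((d - m).+1, 2)] makes both sides equal for every [m], which lets the induction run;
    it vanishes once [d <= m]. *)
Lemma sum_minn_ge d m :
  d * m + 'C((d - m).+1, 2) <= \sum_(i < m) minn d i + 'C(d.+1, 2).
Proof.
elim: m => [|m IH]; first by rewrite muln0 big_ord0 subn0.
rewrite big_ord_recr mulnS /=; move: IH; set S := (\sum_(i < m) _).
have [dm | md] := leqP d m => IH.
  have e1 : d - m.+1 = 0 by lia.
  have e2 : d - m = 0 by lia.
  by rewrite e1; rewrite e2 in IH; lia.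
have e : d - m = (d - m.+1).+1 by lia.
by move: IH; rewrite e binS bin1; lia.
Qed.

Definition nbrs {V : finType} (H : rel V) (v : V) (U : {set V}) : {set V} :=
  [set u in U | H v u].

Section RankGrowth.
Context {V : finType} {H : rel V} {rk : {set V} -> nat} {d : nat}.
Hypotheses (H_sym : symmetric H) (H_irr : irreflexive H).
(** [gain0] abstracts 0-extension and [gain1] abstracts 1-extension, so that the counting is
    independent of matrices. *)
Hypothesis gain0 : forall v (U : {set V}), v \notin U ->
  rk U + minn d #|nbrs H v U| <= rk (v |: U).
Hypothesis gain1 : forall v (U : {set V}) x y, v \notin U ->
  x \in nbrs H v U -> y \in nbrs H v U -> d < #|nbrs H v U| ->
  x != y -> ~~ H x y -> rk U + d.+1 <= rk (v |: U).
Implicit Types (U W T : {set V}).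

Definition clique U := [forall x in U, forall y in U, (x != y) ==> H x y].

Lemma cliqueP U :
  reflect {in U &, forall x y, x != y -> H x y} (clique U).
Proof.
apply: (iffP forall_inP) => [cl x y xU yU xy | cl x xU].
  by have /forall_inP/(_ y yU)/implyP := cl x xU; apply.
by apply/forall_inP => y yU; apply/implyP; exact: cl.
Qed.

Lemma cliquePn U : ~~ clique U ->
  exists x y, [/\ x \in U, y \in U, x != y & ~~ H x y].
Proof.
case/forall_inPn => x xU /forall_inPn[y yU]; rewrite negb_imply => /andP[xy nH].
by exists x, y.
Qed.

Definition gain v U := if (d < #|nbrs H v U|) && ~~ clique (nbrs H v U)
  then d.+1 else minn d #|nbrs H v U|.

Lemma gainP v U : v \notin U -> rk U + gain v U <= rk (v |: U).
Proof.
move=> vU; rewrite /gain; case: ifP => [/andP[dN]|_]; last exact: gain0.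
by case/cliquePn => x [y [xN yN xy nH]]; exact: gain1 xN yN dN xy nH.
Qed.

(* [x] and [y] both precede [v] with probability 1/3, and then [v] gains
   [d + 1]; at most [d] neighbours precede [v] with probability at most
   [(d + 1) / (#|N| + 1)], which costs at most [d + 1]. *)
Lemma sum_gain_perm v W : v \in W -> 3 * d.+1 ^ 2 <= #|nbrs H v W| ->
  ~~ clique (nbrs H v W) ->
  d * #|{perm V}| <
    \sum_(s : {perm V}) gain v [set u in W | ord_of s u < ord_of s v].
Proof.
move=> vW deg /cliquePn[x [y [xN yN xy nH]]]; set N := nbrs H v W in deg xN yN.
have HvN z : z \in N -> H v z by rewrite inE => /andP[].
have vN : v \notin N by apply/negP => /HvN; rewrite H_irr.
have xv : x != v by apply: contraNneq vN => <-.
have yv : y != v by apply: contraNneq vN => <-.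
(* Position 2 of [v] in [S3] means that [x] and [y] both precede [v]. *)
pose S3 := v |: [set x; y].
have S3x : v \notin [set x; y] by rewrite !inE negb_or ![v == _]eq_sym xv.
have c3 : #|S3| = 3 by rewrite cardsU1 S3x cards2 xy.
have cS : #|v |: N| = #|N|.+1 by rewrite cardsU1 vN.
have pS (S : {set V}) (s : {perm V}) : v \notin S -> pos s (v |: S) v = #|[set u in S | ord_of s u < ord_of s v]|.
  move=> vS; rewrite /pos; congr #|pred_of_set _|; apply/setP => u; rewrite !inE.
  by case: eqVneq => // ->; rewrite ltnn !andbF.
(* If at most [d] neighbours precede [v], the last term alone is [d + 1]. Otherwise the gain is at
   least [d], and it is [d + 1] once [x] and [y] both precede. *)
have pointwise (s : {perm V}) :
    d + (pos s S3 v == #|S3|.-1) <=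
    gain v [set u in W | ord_of s u < ord_of s v] + d.+1 * (pos s (v |: N) v <= d).
  rewrite c3 !pS //=; set U := [set u in W | _].
  have NU : nbrs H v U = [set u in N | ord_of s u < ord_of s v].
    by apply/setP => u; rewrite !inE andbAC.
  rewrite -NU /gain; case: (leqP #|nbrs H v U| d) => dN /=.
    by apply: leq_trans (leq_addl _ _); rewrite muln1 -[d.+1]addn1 leq_add2l leq_b1.
  rewrite muln0 addn0; case: eqP => [c2 | _] /=; last first.
    by rewrite addn0; case: ifP.
  have before : [set x; y] \subset [set u in [set x; y] | ord_of s u < ord_of s v].
    have sub : [set u in [set x; y] | ord_of s u < ord_of s v] \subset [set x; y].
      by apply/subsetP => u; rewrite inE => /andP[].
    by rewrite -(geq_leqif (subset_leqif_card sub)) c2 cards2 xy.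
  have inNU z : z \in N -> z \in [set x; y] -> z \in nbrs H v U.
    by move=> zN /(subsetP before); rewrite NU inE => /andP[_ lt]; rewrite inE zN lt.
  have xU : x \in nbrs H v U by apply: inNU; rewrite // !inE eqxx.
  have yU : y \in nbrs H v U by apply: inNU; rewrite // !inE eqxx orbT.
  rewrite ifT ?addn1 //; apply/cliqueP => /(_ x y xU yU xy).
  by rewrite (negPf nH).
pose A := \sum_(s : {perm V}) (pos s (v |: N) v <= d).
pose B := \sum_(s : {perm V}) (pos s S3 v == #|S3|.-1).
have leA : #|v |: N| * A <= d.+1 * #|{perm V}|.
  by apply: sum_perm_pos_le; rewrite !inE eqxx.
have leB : #|{perm V}| <= #|S3| * B.
  by apply: sum_perm_pos_last; rewrite !inE eqxx.
have P0 : 0 < #|{perm V}| by apply/card_gt0P; exists 1%g.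
have : d * #|{perm V}| + B <=
    \sum_(s : {perm V}) gain v [set u in W | ord_of s u < ord_of s v] + d.+1 * A.
  rewrite [d * _]mulnC -sum_nat_const -big_split /= /A big_distrr -big_split /=.
  exact: leq_sum.
rewrite cS in leA; rewrite c3 in leB.
(* The two bounds give [(#|N| + 1) * A <= 3 * (d + 1) * B] with [B > 0]; the degree bound
   [3 * (d + 1)^2] is what turns this into the claim. *)
suff : d.+1 * A < B by lia.
rewrite ltnNge; apply/negP => BA.
have : (3 * d.+1 ^ 2).+1 * A <= 3 * d.+1 ^ 2 * A.
  apply: leq_trans (_ : d.+1 * (3 * B) <= _).
    apply: leq_trans (_ : #|N|.+1 * A <= _); first by rewrite leq_mul2r ltnS deg orbT.
    by apply: leq_trans leA _; rewrite leq_mul2l leB orbT.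
  apply: leq_trans (_ : d.+1 * (3 * (d.+1 * A)) <= _); last by rewrite expnS expn1; lia.
  by rewrite !leq_mul2l BA !orbT.
have A0 : A = 0 -> False by move=> A0; move: BA; rewrite A0; lia.
by rewrite mulSn; lia.
Qed.

(** Summing [sum_gains_le] over all orders and exchanging the sums, each vertex contributes more
    than [d] on average. *)
Lemma rank_gt_dim W : W != set0 ->
  (forall v, v \in W -> 3 * d.+1 ^ 2 <= #|nbrs H v W|) ->
  (forall v, v \in W -> ~~ clique (nbrs H v W)) -> d * #|W| < rk W.
Proof.
move=> W0 deg ncl.
have P0 : 0 < #|{perm V}| by apply/card_gt0P; exists 1%g.
rewrite -(ltn_pmul2l P0).
apply: leq_trans (_ : \sum_(s : {perm V}) \sum_(v in W)
    gain v [set u in W | ord_of s u < ord_of s v] <= _); last first.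
  rewrite -sum_nat_const; apply: leq_sum => s _.
  by apply: (sum_gains_le _ rk gain (ord_of s) (@ord_of_inj _ s)); exact: gainP.
rewrite exchange_big /=.
apply: leq_trans (_ : \sum_(v in W) (d * #|{perm V}|).+1 <= _); last first.
  by apply: leq_sum => v vW; apply: sum_gain_perm => //; [exact: deg | exact: ncl].
have W1 : 0 < #|W| by rewrite card_gt0.
by rewrite sum_nat_const; nia.
Qed.

(** When a clique is built vertex by vertex, the vertex added to [i] others sees all of them and
    gains [minn d i]. *)
Lemma clique_rank W : clique W -> d * #|W| <= rk W + 'C(d.+1, 2).
Proof.
move=> cl; suff : \sum_(i < #|W|) minn d i <= rk W by have := sum_minn_ge d #|W|; lia.
have [m] := ubnP #|W|; elim: m W cl => // m IH W cl cW.
have [-> | [v vW]] := set_0Vmem W; first by rewrite cards0 big_ord0.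
have vW' : v \notin W :\ v by rewrite !inE eqxx.
have cWv : #|W| = #|W :\ v|.+1 by have := cardsD1 v W; rewrite vW.
rewrite cWv big_ord_recr /=.
have nb : nbrs H v (W :\ v) = W :\ v.
  apply/setP => u; rewrite inE; case: (boolP (u \in W :\ v)) => // /setD1P[uv uW] /=.
  by apply: (cliqueP _ cl) => //; rewrite eq_sym.
have := gain0 _ _ vW'; rewrite (setD1K vW) nb; apply: leq_trans.
rewrite leq_add2r; apply: IH; last lia.
by apply/cliqueP => x y /setD1P[_ xW] /setD1P[_ yW]; exact: (cliqueP _ cl).
Qed.

Definition within W T : rel V := fun a b => [&& a \in W :\: T, b \in W :\: T & H a b].

(* A path through [v] enters and leaves by two neighbours of [v], which are
   equal or adjacent. *)
Lemma connect_delete_simplicial W T v u w : clique (nbrs H v W) ->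
  u \in (W :\ v) :\: T -> w \in (W :\ v) :\: T ->
  connect (within W T) u w -> connect (within (W :\ v) T) u w.
Proof.
move=> /cliqueP cl uW wW; set e' := within (W :\ v) T.
(* Invariant along the path: while it stands at [v], some neighbour of [v] is known to be reachable
   without [v]. *)
pose P z := if z == v then exists2 y, connect e' u y & (y \in (W :\ v) :\: T) && H y v
            else connect e' u z : Prop.
have Pnv z : z \in (W :\ v) :\: T -> P z = connect e' u z.
  by rewrite !inE => /and3P[_ zv _]; rewrite /P (negPf zv).
rewrite -(Pnv w wW) => uw; apply: (@connect_ind_closed _ _ P u w _ uw); last by rewrite Pnv.
move=> a b /and3P[aWT bWT Hab].
have mem z : z != v -> z \in W :\: T -> z \in (W :\ v) :\: T.
  by move=> zv; rewrite !inE zv.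
have [av | av] := eqVneq a v; have [bv | bv] := eqVneq b v.
- by rewrite av bv.
- have bW := mem _ bv bWT; rewrite (Pnv b) // av /P eqxx => -[y uy /andP[yW Hyv]].
  have [<- // | yb] := eqVneq y b.
  apply: connect_trans uy (connect1 _); rewrite /e' /within yW bW /=.
  apply: cl => //.
    by move: yW; rewrite !inE H_sym Hyv => /and3P[_ _ ->].
  by move: bWT; rewrite !inE -av Hab => /andP[_ ->].
- by rewrite (Pnv a) ?mem // bv /P eqxx => ua; exists a; rewrite ?mem //= -bv.
- rewrite !Pnv ?mem // => ua; apply: connect_trans ua (connect1 _).
  by rewrite /e' /within !mem.
Qed.

Lemma connected_rank k W : 3 * d.+1 ^ 2 <= k ->
  (forall U, rk U <= d * #|U|) -> k <= #|W| ->
  (forall T, #|T| < k -> {in W :\: T &, forall u w, connect (within W T) u w}) ->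
  d * #|W| <= rk W + 'C(d.+1, 2).
Proof.
move=> dk rk_le; have [m] := ubnP #|W|; elim: m W => // m IH W cW kW conn.
have [/clique_rank // | ncl] := boolP (clique W).
(* Fewer than [k] neighbours could be removed, which would isolate [v] from its non-neighbour
   [w]. *)
have degree v w : v \in W -> w \in W -> v != w -> ~~ H v w -> k <= #|nbrs H v W|.
  move=> vW wW vw nH; rewrite leqNgt; apply/negP => lt.
  have := conn _ lt v w; rewrite !inE vW wW H_irr (negPf nH) => /(_ isT isT) vcw.
  suff : w = v by move/eqP; rewrite eq_sym (negPf vw).
  apply: (@connect_ind_closed _ _ (fun z => z = v) v w _ vcw) => // a b.
  by case/and3P=> _ /[swap] Hab /[!inE] /andP[/negP bN bW] av; case: bN; rewrite bW -av.
have [x [y [xW yW xy nH]]] := cliquePn _ ncl.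
(* The strict bound leaves at least [k] vertices after one deletion. *)
have big : k.+1 <= #|W|.
  apply: leq_ltn_trans (degree x y xW yW xy nH) _; apply: proper_card.
  apply/properP; split; first by apply/subsetP => u; rewrite inE => /andP[].
  by exists y; rewrite // inE yW.
have min_degree v : v \in W -> k <= #|nbrs H v W|.
  move=> vW; have [/exists_inP[w wW /andP[vw nHw]] | /exists_inPn all_adj] :=
    boolP [exists w in W, (v != w) && ~~ H v w]; first exact: degree vw nHw.
  apply: leq_trans (_ : #|W :\ v| <= _).
    by have := cardsD1 v W; rewrite vW; lia.
  apply/subset_leq_card/subsetP => w /setD1P[wv wW]; rewrite inE wW /=.
  by have := all_adj w wW; rewrite eq_sym wv /= negbK.
(* Without a simplicial vertex the rank would exceed its upper bound [d * #|W|]. *)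
have [/exists_inP[v vW cl] | /exists_inPn ncl'] :=
    boolP [exists v in W, clique (nbrs H v W)]; last first.
  have W0 : W != set0 by apply/set0Pn; exists x.
  have := rank_gt_dim W W0 (fun v vW => leq_trans dk (min_degree v vW)) ncl'.
  by have := rk_le W; lia.
have vW' : v \notin W :\ v by rewrite !inE eqxx.
have cWv : #|W| = #|W :\ v|.+1 by have := cardsD1 v W; rewrite vW.
have := gain0 _ _ vW'; rewrite (setD1K vW).
have -> : nbrs H v (W :\ v) = nbrs H v W.
  apply/setP => u; rewrite !inE; case: eqVneq => // ->.
  by rewrite H_irr !andbF.
rewrite (minn_idPl _); last by have := min_degree v vW; lia.
suff : d * #|W :\ v| <= rk (W :\ v) + 'C(d.+1, 2) by rewrite cWv; lia.
apply: IH; [lia | lia | move=> T cT u w uW wW].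
apply: connect_delete_simplicial => //; apply: conn => //.
  by move: uW; rewrite !inE => /and3P[-> _ ->].
by move: wW; rewrite !inE => /and3P[-> _ ->].
Qed.

End RankGrowth.

Import Order.TTheory GRing.Theory Num.Theory.
Local Open Scope ring_scope.

(** * Generic frameworks *)

(** Matrices [K] and [L] compress the matrix at [t0] to an identity of the size of its rank. The
    determinant of the compressed pencil is a polynomial in [t] with value 1 at [t0], and the rank
    cannot drop where it is nonzero. *)
Lemma rank_line_generic (R : fieldType) m n (M0 M1 : 'M[R]_(m, n)) (t0 : R) :
  exists2 P : {poly R}, P != 0 &
    forall t, ~~ root P t -> (\rank (M0 + t0 *: M1)%R <= \rank (M0 + t *: M1)%R)%N.
Proof.
set A := M0 + t0 *: M1.
have [L HL] := row_freeP (row_base_free A).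
have [K HK] := row_fullP (col_base_full A).
have HA : K *m A *m L = 1%:M.
  by rewrite -[X in K *m X](mulmx_base A) mulmxA HK mul1mx HL.
pose B := map_mx polyC (K *m M0 *m L) + 'X *: map_mx polyC (K *m M1 *m L).
have HB t : map_mx (horner_eval t) B = K *m (M0 + t *: M1) *m L.
  rewrite mulmxDr mulmxDl -scalemxAr -scalemxAl.
  by apply/matrixP => i j; rewrite /B !mxE /horner_eval !hornerE.
exists (\det B).
  apply/eqP => B0.
  have := congr1 (horner_eval t0) B0.
  rewrite -det_map_mx HB HA det1 /horner_eval horner0 => /eqP.
  by rewrite oner_eq0.
move=> t; rewrite /root -[_.[t]]/(horner_eval t (\det B)) -det_map_mx HB => nz.
have : K *m (M0 + t *: M1) *m L \in unitmx by rewrite unitmxE unitfE.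
move/mxrank_unit => rk.
rewrite -/A -[leqLHS]rk.
apply: leq_trans (mxrankM_maxl _ _) _; exact: mxrankM_maxr.
Qed.

Lemma exists_nonroot (R : numDomainType) (P : {poly R}) :
  P != 0 -> exists t, ~~ root P t.
Proof.
move=> nz; pose s : seq R := [seq i%:R | i <- iota 0 (size P)].
have : ~~ all (root P) s.
  apply/negP => rs; suff : (size s < size P)%N by rewrite size_map size_iota ltnn.
  apply: max_poly_roots => //; rewrite map_inj_uniq ?iota_uniq // => i j.
  by move/eqP; rewrite eqr_nat => /eqP.
by case/allPn => t _ nr; exists t.
Qed.

(* A point maximising the sum of all the ranks maximises each of them: if [q]
   beat it for [M i], so would a generic point of the line through both,
   without loss for the other matrices. *)
Lemma simultaneous_max_rank (R : numFieldType) (T : lmodType R) (I : finType)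
    (m n : I -> nat) (M : forall i, T -> 'M[R]_(m i, n i)) (linM : forall i, linear (M i)) :
  exists p, forall i q, (\rank (M i q) <= \rank (M i p))%N.
Proof.
pose total p := (\sum_i \rank (M i p))%N.
have [||N /asboolP[p Np] maxN] := @ex_maxnP (fun N => `[< exists p, total p = N >]) (\sum_i m i)%N.
- by exists (total 0); apply/asboolP; exists 0.
- by move=> N /asboolP[p <-]; apply: leq_sum => i _; exact: rank_leq_row.
exists p => i q.
have line (t : R) j : M j (p + t *: (q - p)) = M j p + t *: M j (q - p).
  by rewrite addrC linM addrC.
pose good (P : {poly R}) j := forall t, ~~ root P t ->
  (\rank (M j p) <= \rank (M j (p + t *: (q - p))%R))%N.
(* The line passes through [p] at parameter 0; the product of the polynomials serves all matrices at
   once. *)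
have [P Pnz PP] : exists2 P : {poly R}, P != 0 & forall j, good P j.
  have ex j : exists P : {poly R}, P != 0 /\ good P j.
    have [P nz HP] := rank_line_generic R _ _ (M j p) (M j (q - p)) 0.
    by exists P; split=> // t /HP; rewrite scale0r addr0 line.
  have [F HF] := choice ex.
  exists (\prod_j F j).
    by apply/prodf_neq0 => j _; case: (HF j).
  move=> j t; rewrite rootE horner_prod => /prodf_neq0 /(_ j isT) nr.
  by case: (HF j) => _; apply.
(* At parameter 1 the line passes through [q]. *)
have [Q Qnz QQ] := rank_line_generic R _ _ (M i p) (M i (q - p)) 1.
have [t] := exists_nonroot _ _ (mulf_neq0 Pnz Qnz).
rewrite rootM negb_or => /andP[tP tQ].
have := QQ t tQ; rewrite -!line scale1r [p + _]addrC subrK => /leq_trans; apply.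
rewrite leqNgt; apply/negP => lt_i.
have : (total (p + t *: (q - p))%R <= total p)%N.
  by rewrite Np; apply: maxN; apply/asboolP; exists (p + t *: (q - p)).
rewrite leqNgt => /negP; apply.
rewrite /total (bigD1 i) //= [in ltnRHS](bigD1 i) //=.
rewrite -addSn leq_add //; apply: leq_sum => j _; exact: PP.
Qed.

(** Elements outside [A] give zero rows, so the shape does not depend on [A]. *)
Definition span_mx {R : fieldType} {T : finType} {n : nat} (f : T -> 'rV[R]_n)
    (A : {set T}) : 'M[R]_(#|T|, n) :=
  \matrix_(i < #|T|) (if enum_val i \in A then f (enum_val i) else 0).

Lemma span_mx_subP (R : fieldType) (T : finType) m n (f : T -> 'rV[R]_n)
    (A : {set T}) (B : 'M[R]_(m, n)) :
  reflect (forall x, x \in A -> (f x <= B)%MS) (span_mx f A <= B)%MS.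
Proof.
apply: (iffP row_subP) => [sub x xA | sub i].
  by have := sub (enum_rank x); rewrite rowK enum_rankK xA.
by rewrite rowK; case: ifP => [/sub//|_]; exact: sub0mx.
Qed.

Lemma mem_span_mx {R : fieldType} {T : finType} {n} (f : T -> 'rV[R]_n)
    {A : {set T}} {x : T} : x \in A -> (f x <= span_mx f A)%MS.
Proof. by move=> xA; exact: (span_mx_subP _ _ _ _ _ _ _ (submx_refl _)). Qed.

Lemma span_mxS (R : fieldType) (T : finType) n (f : T -> 'rV[R]_n)
    (A B : {set T}) : A \subset B -> (span_mx f A <= span_mx f B)%MS.
Proof.
by move=> /subsetP sAB; apply/span_mx_subP => x /sAB; exact: mem_span_mx.
Qed.

(** Rank-nullity for [B] on the sum: the kernel contains [A] and the image contains that of [D]. *)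
Lemma rank_adds_block (F : fieldType) m1 m2 n k (A : 'M[F]_(m1, n))
    (D : 'M[F]_(m2, n)) (B : 'M[F]_(n, k)) :
  A *m B = 0 -> (\rank A + \rank (D *m B) <= \rank (A + D)%MS)%N.
Proof.
move=> AB0; rewrite -(mxrank_mul_ker (A + D)%MS B) addnC leq_add //.
  by apply/mxrankS/submxMr; exact: addsmxSr.
by apply: mxrankS; rewrite sub_capmx addsmxSl; apply/sub_kermxP.
Qed.

Lemma mxrank_sums_le (F : fieldType) (I : finType) n (P : pred I)
    (A : I -> 'M[F]_n) :
  (\rank (\sum_(i | P i) A i)%MS <= \sum_(i | P i) \rank (A i))%N.
Proof.
elim/big_rec2: _ => [|i r M _ le]; first by rewrite mxrank0.
by apply: leq_trans (mxrank_adds_leqif _ _).1 _; rewrite leq_add2l.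
Qed.

(** * Edge rows and generic embeddings *)

Section Framework.
Context {R : numFieldType} {d : nat} {V : finType}.
Implicit Types (p q : {ffun V -> 'rV[R]_d}) (E : {set V * V}) (N U : {set V}).

Definition axis (v : V) : 'rV[R]_#|V| := delta_mx 0 (enum_rank v).

(** The outer product has [p u - p v] in row [u] and its negative in row [v]; flattened, it is the
    row of the rigidity matrix. *)
Definition edge_row p (e : V * V) : 'rV[R]_(#|V| * d) :=
  mxvec ((axis e.1 - axis e.2)^T *m (p e.1 - p e.2)).

(** Right multiplication by [block w] extracts the [d] columns of the vertex [w]. *)
Definition block (w : V) : 'M[R]_(#|V| * d, d) :=
  lin1_mx (row (enum_rank w) \o vec_mx).

Lemma edge_row_sym p u v : edge_row p (u, v) = edge_row p (v, u).
Proof.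
by rewrite /edge_row /= -[axis u - _]opprB -[p u - _]opprB [(- _)^T]linearN mulNmx mulmxN opprK.
Qed.

Lemma edge_row_block p u v w :
  edge_row p (u, v) *m block w = ((u == w)%:R - (v == w)%:R) *: (p u - p v).
Proof.
rewrite mul_rV_lin1 /= mxvecK row_mul -mul_scalar_mx; congr (_ *m _).
apply/rowP => i; rewrite !ord1 !mxE !eqxx /=.
by rewrite !(inj_eq enum_rank_inj) ![w == _]eq_sym mulr1n.
Qed.

Definition edge_rank p E : nat := \rank (span_mx (edge_row p) E).

(** The first clause is genericity for the rigidity matroid, the second is affine general position.
    Both concern finitely many matrices linear in [p]. *)
Definition generic p : Prop :=
  (forall q E, (edge_rank q E <= edge_rank p E)%N) /\
  (forall v N, v \notin N ->
     (minn d #|N| <= \rank (span_mx (fun z => p v - p z)%R N))%N).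

(** The first [d] elements of [N] go to distinct unit vectors, everything else to the origin. *)
Lemma exists_general_position (v : V) N : v \notin N ->
  exists q : {ffun V -> 'rV[R]_d},
    (minn d #|N| <= \rank (span_mx (fun z => q v - q z)%R N))%N.
Proof.
move=> vN; pose coord z : 'rV[R]_d :=
  if insub (index z (enum N)) is Some j then delta_mx 0 j else 0.
exists [ffun z => if z \in N then coord z else 0].
set f := (X in span_mx X _).
have le1 : (minn d #|N| <= d)%N by exact: geq_minl.
rewrite -[leqLHS](@rank_pid_mx R (minn d #|N|) d (minn d #|N|)) //.
apply/mxrankS/row_subP => i.
have iN : (i < size (enum N))%N.
  by rewrite -cardE; apply: leq_trans (ltn_ord i) (geq_minr _ _).
have id : (i < d)%N by apply: leq_trans (ltn_ord i) _.
pose z := nth v (enum N) i.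
have zN : z \in N by rewrite -mem_enum mem_nth.
have -> : row i (pid_mx (minn d #|N|)) = - f z.
  rewrite /f !ffunE (negPf vN) zN sub0r opprK /coord.
  rewrite index_uniq ?enum_uniq // insubT.
  by apply/rowP => j; rewrite !mxE ltn_ord andbT eqxx -val_eqE /= eq_sym.
by rewrite eqmx_opp; apply: mem_span_mx.
Qed.

Lemma linear_span_mx (T : finType) n (f : {ffun V -> 'rV[R]_d} -> T -> 'rV[R]_n)
    (A : {set T}) :
  (forall x, linear (f^~ x)) -> linear (fun p => span_mx (f p) A).
Proof.
move=> linf a p q; apply/row_matrixP => i.
rewrite linearP /= !rowK; case: ifP => _; first exact: linf.
by rewrite scaler0 addr0.
Qed.

Lemma exists_generic : exists p, generic p.
Proof.
pose I : finType := ({set V * V} + V * {set V})%type.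
pose m (i : I) := match i with inl _ => #|{: V * V}| | inr _ => #|V| end.
pose n (i : I) := match i with inl _ => (#|V| * d)%N | inr _ => d end.
pose M (i : I) p := match i return 'M[R]_(m i, n i) with
  | inl E => span_mx (edge_row p) E
  | inr (v, N) => span_mx (fun z => p v - p z) N end.
have linM i : linear (M i).
  case: i => [E | [v N]]; apply: linear_span_mx => x a p q /=.
    rewrite /edge_row !ffunE opprD addrACA -scalerBr mulmxDr -scalemxAr.
    exact: linearP.
  by rewrite !ffunE opprD addrACA -scalerBr.
have [p Hp] := simultaneous_max_rank R _ I m n M linM.
exists p; split=> [q E | v N vN]; first exact: (Hp (inl E)).
have [q Hq] := exists_general_position _ _ vN.
exact: leq_trans Hq (Hp (inr (v, N)) q).
Qed.

End Framework.

(** * 0-extension and 1-extension *)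

Section Extension.
Context {R : numFieldType} {d : nat} {V : finType}.
Implicit Types (p q : {ffun V -> 'rV[R]_d}) (H : rel V) (N U : {set V}) (v : V).

(** A symmetric relation lists each edge in both orientations; their rows coincide, so ranks are
    unaffected. *)
Definition induced H U : {set V * V} :=
  [set e | [&& e.1 \in U, e.2 \in U & H e.1 e.2]].

Definition star v N : {set V * V} := [set (v, z) | z in N].

Lemma inducedS H U U' : U \subset U' -> induced H U \subset induced H U'.
Proof.
move=> /subsetP sU; apply/subsetP => e; rewrite !inE.
by case/and3P => /sU -> /sU -> ->.
Qed.

Lemma star_induced H v U : star v (nbrs H v U) \subset induced H (v |: U).
Proof.
by apply/subsetP => _ /imsetP[z /[!inE] /andP[zU Hz] ->] /=; rewrite eqxx zU Hz orbT.
Qed.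

Lemma induced_block0 p H U v : v \notin U ->
  span_mx (edge_row p) (induced H U) *m block v = 0.
Proof.
move=> vU; apply/sub_kermxP/span_mx_subP => -[x y] /[!inE] /= /and3P[xU yU _].
apply/sub_kermxP; rewrite edge_row_block.
have neq z : z \in U -> (z == v) = false by move=> zU; apply: contraNF vU => /eqP <-.
by rewrite !neq // subrr scale0r.
Qed.

Lemma star_block q v N : v \notin N ->
  (span_mx (fun z => q v - q z)%R N <= span_mx (edge_row q) (star v N) *m block v)%MS.
Proof.
move=> vN; apply/span_mx_subP => z zN.
have /negPf zv : z != v by apply: contraNneq vN => <-.
have <- : edge_row q (v, z) *m block v = q v - q z.
  by rewrite edge_row_block eqxx zv subr0 scale1r.
by apply: submxMr; apply: mem_span_mx; exact: imset_f.
Qed.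

(** The old rows vanish on the columns of [v], where the new rows are the vectors [p v - p z], of
    rank at least [minn d #|nbrs H v U|] by general position. *)
Lemma zero_extension p H U v : generic p -> v \notin U ->
  (edge_rank p (induced H U) + minn d #|nbrs H v U| <=
     edge_rank p (induced H (v |: U)))%N.
Proof.
move=> [_ gen] vU.
have vN : v \notin nbrs H v U by rewrite inE (negPf vU).
apply: leq_trans (_ : \rank (span_mx (edge_row p) (induced H U) +
    span_mx (edge_row p) (star v (nbrs H v U)))%MS <= _)%N; last first.
  by apply: mxrankS; rewrite addsmx_sub !span_mxS ?star_induced ?inducedS ?subsetUr.
apply: leq_trans (rank_adds_block _ _ _ _ _ _ _ (block v) (induced_block0 p H _ _ vU)).
rewrite leq_add2l; apply: leq_trans (gen _ _ vN) _.
by apply: mxrankS; exact: star_block.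
Qed.

(* Placing [v] at the midpoint of [x] and [y] makes the row of [xy] twice the
   sum of the rows of [vx] and [vy]; the generic rank is at least the rank at
   this special position. *)
Lemma one_extension p H U v x y : generic p -> v \notin U ->
    x \in nbrs H v U -> y \in nbrs H v U -> (d < #|nbrs H v U|)%N ->
    ~~ (edge_row p (x, y) <= span_mx (edge_row p) (induced H U))%MS ->
  (edge_rank p (induced H U) + d.+1 <= edge_rank p (induced H (v |: U)))%N.
Proof.
move=> [gen_rank gen_pos] vU xN yN dN new.
set N := nbrs H v U in xN yN dN.
have NU z : z \in N -> z \in U by rewrite inE => /andP[].
have neq z : z \in U -> (z == v) = false by move=> zU; apply: contraNF vU => /eqP <-.
have vN : v \notin N by apply: contra vU; exact: NU.
pose q : {ffun V -> 'rV[R]_d} :=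
  [ffun z => if z == v then 2^-1 *: (p x + p y) else p z].
have qE z : z \in U -> q z = p z by move=> /neq zv; rewrite ffunE zv.
have qv : q v = 2^-1 *: (p x + p y) by rewrite ffunE eqxx.
apply: leq_trans (gen_rank q _).
set A := span_mx (edge_row p) (induced H U).
pose D := span_mx (edge_row q) (star v N).
have AD : (A + edge_row p (x, y) + D <= span_mx (edge_row q) (induced H (v |: U)))%MS.
  have sD : (D <= span_mx (edge_row q) (induced H (v |: U)))%MS.
    by apply: span_mxS; exact: star_induced.
  have sDz z : z \in N -> (edge_row q (v, z) <= span_mx (edge_row q) (induced H (v |: U)))%MS.
    by move=> zN; apply: submx_trans sD; apply: mem_span_mx; exact: imset_f.
  rewrite !addsmx_sub sD andbT; apply/andP; split.
    apply/span_mx_subP => -[a b] abU; have := abU; rewrite inE /= => /and3P[aU bU _].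
    have -> : edge_row p (a, b) = edge_row q (a, b) by rewrite /edge_row /= !qE.
    by apply: mem_span_mx; apply: subsetP abU; apply: inducedS; exact: subsetUr.
  have -> : edge_row p (x, y) = 2 *: (edge_row q (v, x) + edge_row q (v, y)).
    rewrite /edge_row /= (qE x) ?(qE y) ?NU // qv -linearD -linearZ /=; congr mxvec.
    have -> : 2^-1 *: (p x + p y) - p x = - (2^-1 *: (p x - p y)).
      by apply/rowP => i; rewrite !mxE; field.
    have -> : 2^-1 *: (p x + p y) - p y = 2^-1 *: (p x - p y).
      by apply/rowP => i; rewrite !mxE; field.
    rewrite mulmxN -mulNmx -mulmxDl -scalemxAr scalerA divff ?pnatr_eq0 // scale1r.
    by congr (_ *m _); apply/matrixP => i j; rewrite !mxE; ring.
  by apply: scalemx_sub; rewrite addmx_sub ?sDz.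
apply: leq_trans (mxrankS AD).
have A0 : (A + edge_row p (x, y))%MS *m block v = 0.
  apply/sub_kermxP; rewrite addsmx_sub; apply/andP; split; apply/sub_kermxP.
    exact: induced_block0.
  by rewrite edge_row_block !neq ?NU // subrr scale0r.
apply: leq_trans (rank_adds_block _ _ _ _ _ _ _ _ A0).
(* The row of [xy] adds one to the rank of the old rows; the columns of [v] must supply the
   remaining [d]. *)
rewrite addnS -addSn leq_add //.
  apply: rank_ltmx; rewrite ltmxE addsmxSl /= addsmx_sub.
  by rewrite (negPf new) andbF.
(* The span of the vectors [q v - q z] contains [p y - p z] for the at least [d] other neighbours
   [z], and these have rank at least [d] by general position. *)
have yNy : y \notin N :\ y by rewrite !inE eqxx.
apply: leq_trans (_ : minn d #|N :\ y| <= _)%N.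
  by have := cardsD1 y N; rewrite yN; lia.
apply: leq_trans (gen_pos _ _ yNy) _.
apply: leq_trans (mxrankS (star_block q v N vN)).
apply/mxrankS/span_mx_subP => z /[!inE] /andP[_ /andP[zU Hz]].
have -> : p y - p z = (q v - q z) - (q v - q y).
  by rewrite (qE z) // (qE y) ?NU // opprB [RHS]addrC addrA subrK.
have sub z' : z' \in N -> (q v - q z' <= span_mx (fun z => q v - q z)%R N)%MS.
  exact: (mem_span_mx (fun z => q v - q z)).
by rewrite addmx_sub ?eqmx_opp ?sub // inE zU.
Qed.

(** All rows are supported on the [d] columns of each vertex in [U]. *)
Lemma edge_rank_le_dim p H U : (edge_rank p (induced H U) <= d * #|U|)%N.
Proof.
pose lift (v : V) : 'M[R]_(d, #|V| * d) := lin1_mx (mxvec \o mulmx (axis v)^T).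
have liftE v a : a *m lift v = mxvec ((axis v)^T *m a) by rewrite mul_rV_lin1.
apply: leq_trans (_ : \rank (\sum_(v in U) <<lift v>>)%MS <= _)%N.
  apply/mxrankS/span_mx_subP => -[x y] /[!inE] /= /and3P[xU yU _].
  rewrite /edge_row /= [(_ - _)^T]linearB mulmxBl linearB /= -!liftE addmx_sub ?eqmx_opp //.
    by rewrite (sumsmx_sup x) // genmxE submxMl.
  by rewrite (sumsmx_sup y) // genmxE submxMl.
apply: leq_trans (mxrank_sums_le _ _ _ _ _) _.
rewrite [leqRHS]mulnC -sum_nat_const; apply: leq_sum => v _.
by rewrite mxrank_gen; exact: rank_leq_row.
Qed.

End Extension.

(** * Trivial motions and the upper bound on the rank *)

Lemma card_le_pairs (d : nat) :
  #|{: {ij : 'I_d * 'I_d | (ij.1 <= ij.2)%N}}| = 'C(d.+1, 2).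
Proof.
rewrite card_sig -sum1_card.
rewrite -(pair_big_dep xpredT (fun i j : 'I_d => (i <= j)%N) (fun _ _ => 1%N)) /=.
rewrite (exchange_big_dep xpredT) //= -bin2_sum big_nat_recl // add0n big_mkord.
apply: eq_bigr => j _; rewrite (big_ord_narrow (ltn_ord j)).
by rewrite sum_nat_const card_ord muln1.
Qed.

Section TrivialMotions.
Context {R : numFieldType} {d : nat} {V : finType}.
Implicit Types (p : {ffun V -> 'rV[R]_d}).

(* Translations are indexed by the pairs [(i, i)], and rotations by the pairs
   [(i, j)] with [i < j]. *)
Definition motion p (ij : 'I_d * 'I_d) : 'M[R]_(#|V|, d) :=
  if ij.1 == ij.2 then const_mx 1 *m delta_mx (0 : 'I_1) ij.1
  else (\matrix_(a < #|V|) p (enum_val a)) *m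
         (delta_mx ij.1 ij.2 - delta_mx ij.2 ij.1).

Lemma axis_mul p v : axis v *m (\matrix_(a < #|V|) p (enum_val a)) = p v.
Proof. by rewrite -rowE rowK enum_rankK. Qed.

(** The relative velocity of the two ends is zero for a translation, and for a rotation it is the
    edge vector times a skew matrix, hence orthogonal to the edge. *)
Lemma motion_edge p e ij : mxvec (motion p ij) *m (edge_row p e)^T = 0.
Proof.
apply: trmx_inj; rewrite trmx_mul trmxK trmx0 /edge_row mxvec_dotmul /motion.
case: ifP => _.
  have c0 : (axis e.1 - axis e.2) *m const_mx 1 = 0 :> 'M[R]_1.
    by rewrite mulmxBl /axis -!rowE !row_const subrr.
  by rewrite mulmxA c0 !mul0mx.
rewrite mulmxA mulmxBl !axis_mul; set w := p e.1 - p e.2.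
rewrite mulmxBr mulmxBl; apply/eqP; rewrite subr_eq0; apply/eqP.
have tr (M : 'M[R]_1) : M = M^T by apply/matrixP => a b; rewrite mxE !ord1.
by rewrite [LHS]tr !trmx_mul trmxK trmx_delta mulmxA.
Qed.

(** The trivial motions are orthogonal to every edge row, so it suffices that they are linearly
    independent. *)
Lemma edge_rank_trivial_motions p (E : {set V * V}) : generic p -> (d < #|V|)%N ->
  (edge_rank p E + 'C(d.+1, 2) <= d * #|V|)%N.
Proof.
move=> [_ gen] dV; rewrite -card_le_pairs mulnC.
pose Q := {ij : 'I_d * 'I_d | (ij.1 <= ij.2)%N}; pose ij (x : 'I_#|{: Q}|) := val (enum_val x).
pose K : 'M[R]_(#|{: Q}|, #|V| * d) := \matrix_x mxvec (motion p (ij x)).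
suff freeK : row_free K.
  move: freeK; rewrite -row_leq_rank => rK.
  apply: leq_trans (leq_add (leqnn _) rK) _; rewrite -(mxrank_tr K).
  apply: mulmx0_rank_max; apply/sub_kermxP/span_mx_subP => e _.
  apply/sub_kermxP/trmx_inj; rewrite trmx_mul trmxK trmx0.
  by apply/row_matrixP => x; rewrite row_mul rowK motion_edge row0.
apply: inj_row_free => w wK0.
(* A linear relation [w] among the motions combines into one skew matrix [T] and one translation
   [t]. *)
pose T : 'M[R]_d := \sum_x w 0 x *:
  (if (ij x).1 == (ij x).2 then 0 else delta_mx (ij x).1 (ij x).2 - delta_mx (ij x).2 (ij x).1).
pose t : 'rV[R]_d := \sum_x w 0 x *:
  (if (ij x).1 == (ij x).2 then delta_mx 0 (ij x).1 else 0).
have PTt : const_mx 1 *m t + (\matrix_(a < #|V|) p (enum_val a)) *m T = 0.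
  apply: (can_inj mxvecK); rewrite [RHS]linear0 -wK0 mulmx_sum_row.
  rewrite !mulmx_sumr -big_split linear_sum /=; apply: eq_bigr => x _.
  rewrite rowK -linearZ /=; congr mxvec; rewrite -!scalemxAr -scalerDr /motion.
  by case: ifP => _; rewrite mulmx0 ?addr0 ?add0r.
have pTt v : t + p v *m T = 0.
  have := congr1 (mulmx (axis v)) PTt; rewrite mulmx0 mulmxDr !mulmxA axis_mul.
  by rewrite {1}/axis -rowE row_const [const_mx 1]mx11_scalar mxE mul1mx.
(* [T] kills all differences [p v0 - p z], which span the whole space because at least [d] other
   vertices exist. *)
have T0 : T = 0.
  have [v0 _] : exists v0 : V, v0 \in V by apply/card_gt0P; exact: leq_trans dV.
  have vN : v0 \notin [set~ v0] by rewrite !inE eqxx.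
  have rS := gen v0 _ vN; rewrite cardsC1 (minn_idPl _) in rS; last by lia.
  apply/eqP; rewrite -mxrank_eq0 -leqn0 -(leq_add2l d) addn0.
  apply: leq_trans (leq_add rS (leqnn _)) _; apply: mulmx0_rank_max.
  apply/sub_kermxP/span_mx_subP => z _; apply/sub_kermxP; rewrite mulmxBl.
  by apply/eqP; rewrite subr_eq0; apply/eqP/(addrI t); rewrite !pTt.
have t0 : t = 0.
  have [v0 _] : exists v0 : V, v0 \in V by apply/card_gt0P; exact: leq_trans dV.
  by rewrite -(pTt v0) T0 mulmx0 addr0.
have ij_inj x y : (ij x).1 = (ij y).1 -> (ij x).2 = (ij y).2 -> x = y.
  move=> e1 e2; apply: enum_val_inj; apply: val_inj.
  by move: e1 e2; rewrite /ij; case: (val _) => ? ?; case: (val _) => ? ? /= -> ->.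
(* Each coefficient of [w] is an entry of [t] or an entry of [T] above the diagonal. *)
apply/rowP => x; rewrite [RHS]mxE.
have [xx | xx] := eqVneq (ij x).1 (ij x).2.
  have := congr1 (fun M : 'rV_d => M 0 (ij x).1) t0; rewrite summxE mxE.
  rewrite (bigD1 x) //= big1 ?addr0 => [|y yx].
    by rewrite xx eqxx !mxE !eqxx mulr1.
  rewrite mxE; case: eqVneq => [yy|_]; last by rewrite mxE mulr0.
  rewrite mxE eqxx /=; case: eqVneq => [xy|_]; last by rewrite mulr0.
  by case/eqP: yx; apply: ij_inj; rewrite -?yy -?xx.
have := congr1 (fun M : 'M_d => M (ij x).1 (ij x).2) T0; rewrite summxE mxE.
rewrite (bigD1 x) //= big1 ?addr0 => [|y yx].
  by rewrite (negPf xx) !mxE !eqxx [(ij x).2 == _]eq_sym (negPf xx) andbF subr0 mulr1.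
rewrite mxE; case: eqVneq => [yy|yy]; first by rewrite mxE mulr0.
rewrite !mxE.
have -> : ((ij x).1 == (ij y).1) && ((ij x).2 == (ij y).2) = false.
  by apply/negP => /andP[/eqP e1 /eqP e2]; case/eqP: yx; exact: ij_inj.
have -> : ((ij x).1 == (ij y).2) && ((ij x).2 == (ij y).1) = false.
  apply/negP => /andP[/eqP e1 /eqP e2].
  have := valP (enum_val x); rewrite -/(ij x) /= e1 e2 => le1.
  by case/eqP: yy; apply/val_inj/anti_leq; rewrite le1 andbT; exact: valP (enum_val y).
by rewrite subr0 mulr0.
Qed.

End TrivialMotions.

(** * Rigidity *)

Lemma row_rigidity_mx (R : realType) (d : nat) (G : sgraph) (p : {ffun G -> 'rV[R]_d})
    (i : 'I_#|edges G|) (u v : G) :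
  u != v -> enum_val i = [set u; v] -> row i (rigidity_mx p) = edge_row p (u, v).
Proof.
move=> uv iE; rewrite rowK; congr mxvec; apply/matrixP => j c.
rewrite !mxE big_ord1 !mxE iE /= !inE big_setU1 ?inE //= big_set1 !mxE.
have rk x : (j == enum_rank x) = (enum_val j == x) :> bool.
  by rewrite -(inj_eq enum_val_inj) enum_rankK.
rewrite !rk; have [-> | ju] := eqVneq (enum_val j) u.
  by rewrite (negPf uv) /=; ring.
by have [-> | jv] := eqVneq (enum_val j) v; rewrite /=; ring.
Qed.

Lemma rank_rigidity_mx (R : realType) (d : nat) (G : sgraph)
    (p : {ffun G -> 'rV[R]_d}) :
  \rank (rigidity_mx p) = edge_rank p (induced (@adj G) setT).
Proof.
have adj_neq (u v : G) : adj u v -> u != v.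
  by apply: contraTneq => ->; rewrite adj_irr.
apply/eqP; rewrite eqn_leq; apply/andP; split; apply: mxrankS.
  apply/row_subP => i; have := enum_valP i; rewrite inE.
  case/existsP => u /existsP[v /andP[uv /eqP iE]].
  rewrite (row_rigidity_mx _ _ _ _ _ _ _ (adj_neq _ _ uv) iE).
  by apply: mem_span_mx; rewrite !inE uv.
apply/span_mx_subP => -[u v] /[!inE] /= uv.
have uvE : [set u; v] \in edges G.
  by rewrite inE; apply/existsP; exists u; apply/existsP; exists v; rewrite uv eqxx.
rewrite -(row_rigidity_mx _ _ _ _ (enum_rank_in uvE [set u; v]) _ _ (adj_neq _ _ uv)).
  exact: row_sub.
by rewrite enum_rankK_in.
Qed.

(** General position for [N = [set y]] says that [p x - p y] is nonzero. *)
Lemma generic_injective (R : numFieldType) (d : nat) (V : finType)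
    (p : {ffun V -> 'rV[R]_d}) : (0 < d)%N -> generic p -> injective p.
Proof.
move=> d0 [_ gen] x y pxy; apply/eqP/negP => /negP xy.
have xN : x \notin [set y] by rewrite inE.
have := gen _ _ xN; rewrite cards1 (minn_idPr d0) leqNgt ltnS leqn0 mxrank_eq0.
by rewrite -submx0 => /negP; apply; apply/span_mx_subP => z /set1P ->; rewrite pxy subrr sub0mx.
Qed.

Lemma k_connected_d_rigid (R : realType) (d k : nat) (G : sgraph) :
  (0 < d)%N -> (3 * d.+1 ^ 2 <= k)%N -> k_connected k G -> d_rigid R d G.
Proof.
move=> d0 dk [kG conn].
have dG : (d < #|G|)%N by nia.
have [p gen] := @exists_generic R d G.
split=> //; exists p; split; first exact: generic_injective.
rewrite rank_rigidity_mx; set A := induced _ _.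
(* The closure of the edge set in the generic rigidity matroid. *)
pose H : rel G := fun x y =>
  (x != y) && (edge_row p (x, y) <= span_mx (edge_row p) A)%MS.
have H_sym : symmetric H by move=> x y; rewrite /H edge_row_sym eq_sym.
have H_irr : irreflexive H by move=> x; rewrite /H eqxx.
have adjH (x y : G) : adj x y -> H x y.
  move=> xy; rewrite /H mem_span_mx ?inE //= andbT.
  by apply: contraTneq xy => ->; rewrite adj_irr.
have spanH U : (span_mx (edge_row p) (induced H U) <= span_mx (edge_row p) A)%MS.
  by apply/span_mx_subP => -[x y] /[!inE] /= /and3P[_ _ /andP[]].
have lower : (d * #|[set: G]| <= edge_rank p (induced H setT) + 'C(d.+1, 2))%N.
  apply: (@connected_rank G H (fun U => edge_rank p (induced H U)) d _ _ _ _ k) => //.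
  - by move=> v U vU; exact: zero_extension.
  (* A pair missing from the closure has its row outside the span of [A], hence outside the smaller
     span of [induced H U]. *)
  - move=> v U x y vU xN yN dN xy nH; apply: one_extension xN yN dN _ => //.
    by apply: contra nH => /submx_trans /(_ (spanH U)) sub; rewrite /H xy.
  - by move=> U; exact: edge_rank_le_dim.
  - by rewrite cardsT ltnW.
  move=> T cT u w; rewrite !inE !andbT => uT wT.
  apply: connect_sub (conn T cT u w uT wT) => a b /and3P[aT bT ab].
  by apply: connect1; rewrite /within !inE aT bT adjH.
have upper := edge_rank_trivial_motions p A gen dG.
have mono : (edge_rank p (induced H setT) <= edge_rank p A)%N by exact: mxrankS.
by rewrite cardsT in lower; lia.
Qed.

Theorem theorem1p3 (R : realType) :
  exists C : R, 0 < C /\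
    forall (n d k : nat) (G : sgraph),
      (1 < n)%N -> (1 <= d)%N -> #|G| = n ->
      C * d%:R ^+ 2 * ln n%:R ^+ 2 <= k%:R ->
      k_connected k G ->
      d_rigid R d G.
Proof.
have ln2 : 0 < ln (2 : R) by rewrite ln_gt0 // ltr1n.
(* Since [n >= 2], the factor [(ln n / ln 2)^2] is at least 1, so
   [k >= 12 d^2 = 3 (2 d)^2 >= 3 (d + 1)^2]. *)
exists (12 / ln 2 ^+ 2); split; first by rewrite divr_gt0 ?exprn_gt0.
move=> n d k G n1 d1 _ Ck; apply: k_connected_d_rigid => //.
have lnn : ln (2 : R) <= ln n%:R by rewrite ler_ln ?posrE ?ltr0n ?ler_nat // ltnW.
have : 12 * d%:R ^+ 2 <= k%:R :> R.
  apply: le_trans Ck.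
  have -> : 12 / ln 2 ^+ 2 * d%:R ^+ 2 * ln n%:R ^+ 2 =
      12 * d%:R ^+ 2 * (ln n%:R / ln 2) ^+ 2 :> R by field; exact: lt0r_neq0.
  rewrite ler_peMr ?mulr_ge0 ?exprn_ge0 ?ler0n //.
  by rewrite exprn_ege1 // ler_pdivlMr // mul1r.
rewrite -natrX -natrM ler_nat => dk; apply: leq_trans dk.
rewrite -[12%N]/(3 * 2 ^ 2)%N -mulnA leq_mul2l /= -expnMn leq_exp2r //; lia.
Qed.
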